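(* Let $a\in\mathbb{H}$ with $\operatorname{Im}a\neq0$, let $c\in\mathbb{R}$, and $L(x)=ax-xa+c$. Put $c_0=|c|/|\operatorname{Im}a|$. Then \[m_{\mathbb{H}}(L)=\log|\operatorname{Im}a|+\frac18\Big((4+c_0^2)\log(4+c_0^2)-2c_0^2\log c_0-4\Big),\] with the convention $0\log0=0$.
   Context: $\mathbb{H}$ denotes the quaternions; $m_{\mathbb{H}}(L)=\int_{|x|=1}\log|L(x)|\,d\mu(x)$ with $\mu$ the probability Haar measure on unit quaternions; $ax-xa$ uses (non-commutative) quaternion multiplication. *)

(* Defs.v *)
From HB Require Import structures.
From mathcomp Require Import all_boot all_order all_algebra.
From mathcomp Require Import all_classical all_reals all_analysis.
Set Implicit Arguments. Unset Strict Implicit. Unset Printing Implicit Defensive.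
Import Order.TTheory GRing.Theory Num.Theory.
Local Open Scope ring_scope.

(* Quaternions x = x0 + x1 i + x2 j + x3 k represented as ((x0,x1),(x2,x3)),
   so that they carry the product (Borel) measurable structure of R^4. *)
Definition quat (R : realType) := ((R * R) * (R * R))%type.

Section Quat.
Variable R : realType.
Definition qmk (x0 x1 x2 x3 : R) : quat R := ((x0, x1), (x2, x3)).
Definition q0 (x : quat R) : R := x.1.1.
Definition q1 (x : quat R) : R := x.1.2.
Definition q2 (x : quat R) : R := x.2.1.
Definition q3 (x : quat R) : R := x.2.2.

Definition qmul (x y : quat R) : quat R :=
  qmk (q0 x * q0 y - q1 x * q1 y - q2 x * q2 y - q3 x * q3 y)
      (q0 x * q1 y + q1 x * q0 y + q2 x * q3 y - q3 x * q2 y)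
      (q0 x * q2 y - q1 x * q3 y + q2 x * q0 y + q3 x * q1 y)
      (q0 x * q3 y + q1 x * q2 y - q2 x * q1 y + q3 x * q0 y).
Definition qadd (x y : quat R) : quat R :=
  qmk (q0 x + q0 y) (q1 x + q1 y) (q2 x + q2 y) (q3 x + q3 y).
Definition qopp (x : quat R) : quat R := qmk (- q0 x) (- q1 x) (- q2 x) (- q3 x).
Definition qreal (c : R) : quat R := qmk c 0 0 0.
Definition qnorm (x : quat R) : R :=
  Num.sqrt (q0 x ^+ 2 + q1 x ^+ 2 + q2 x ^+ 2 + q3 x ^+ 2).
Definition qIm (x : quat R) : quat R := qmk 0 (q1 x) (q2 x) (q3 x).

Definition unit_quats : set (quat R) := [set x | qnorm x = 1].

(* mu is the probability Haar measure on the unit quaternions: a probability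
   measure on H = R^4 concentrated on S^3 and invariant under left
   translation by unit quaternions (this characterizes it uniquely). *)
Definition is_haar_S3 (mu : probability (quat R) R) : Prop :=
  mu unit_quats = 1%E /\
  forall q : quat R, qnorm q = 1 ->
    forall A : set (quat R), measurable A ->
      mu (((fun x => qmul q x) @^-1` A)%classic) = mu A.

Definition elog (r : R) : \bar R := if r == 0 then -oo%E else (ln r)%:E.

Definition mahlerH (mu : probability (quat R) R) (L : quat R -> quat R) : \bar R :=
  (\int[mu]_(x in unit_quats) elog (qnorm (L x)))%E.

Definition sq_log (t : R) : R := if t == 0 then 0 else t ^+ 2 * ln t.
End Quat.

(* Main.v *)
Require Import Defs.
From HB Require Import structures.
From mathcomp Require Import all_boot all_order all_algebra.
From mathcomp Require Import ring lra.
From mathcomp Require Import all_classical all_reals all_analysis.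
From mathcomp Require Import measurable_realfun.
Set Implicit Arguments. Unset Strict Implicit. Unset Printing Implicit Defensive.
Import Order.TTheory GRing.Theory Num.Theory.
Import numFieldNormedType.Exports.
Local Open Scope ring_scope.

(* On the unit sphere |L(x)|^2 = c^2 + 4 (|Im a|^2 - s(x)), where s(x) is
   |Im a|^2 times the squared norm of the projection of x onto the plane
   spanned by 1 and Im a.  Only left invariance of mu is used to find the law
   of s: for e = i, j, k the mean of s((1 + t e) x)^n is (1 + t^2)^n times that
   of s(x)^n, and adding the coefficients of t^2 over the three e gives
   (n + 1) E[s^n] = n |Im a|^2 E[s^(n-1)], i.e. s is uniform on [0, |Im a|^2].
   Expanding log(1 - y) in a power series, all of whose terms have the same
   sign, turns the integral of log|L| into a series of moments by monotone
   convergence, including for c = 0, where log|L| takes the value -oo. *)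

(** * Coefficients of degree at most two in powers of a quadratic polynomial *)

Section QuadraticPowers.
Variable R : comNzRingType.

Definition quad_poly (a b c : R) : {poly R} := a%:P + b *: 'X + c *: 'X^2.

Lemma coef_quad_poly (a b c : R) :
  ((quad_poly a b c)`_0 = a) * ((quad_poly a b c)`_1 = b) *
  ((quad_poly a b c)`_2 = c).
Proof.
by rewrite !coefE /=; do 2?split; rewrite ?(mulr0, mulr1, addr0, add0r).
Qed.

Lemma size_quad_poly (a b c : R) : (size (quad_poly a b c) <= 3)%N.
Proof. by apply/leq_sizeP => -[|[|[|i]]]// _; rewrite !coefE /= !mulr0 !addr0. Qed.

Lemma horner_quad_poly (a b c t : R) :
  (quad_poly a b c).[t] = a + b * t + c * t ^+ 2.
Proof. by rewrite !hornerE. Qed.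

Lemma coef0_quad_poly_exp (a b c : R) n : (quad_poly a b c ^+ n)`_0 = a ^+ n.
Proof.
elim: n => [|n IHn]; first by rewrite !expr0 coef1.
by rewrite exprS coefM big_ord1 /= IHn coef_quad_poly exprS.
Qed.

Lemma coef1_quad_poly_exp (a b c : R) n :
  (quad_poly a b c ^+ n.+1)`_1 = n.+1%:R * a ^+ n * b.
Proof.
elim: n => [|n IHn]; first by rewrite expr1 coef_quad_poly; ring.
rewrite exprS coefM !big_ord_recl big_ord0 /= subn0 IHn.
rewrite coef0_quad_poly_exp.
by rewrite /bump /= !coef_quad_poly exprS -!natr1; ring.
Qed.

(** Doubling avoids halving the binomial coefficient in a general commutative ring. At [n = 0] the
    truncated exponent [n.-1] does no harm, since its factor [n%:R] vanishes. *)
Lemma coef2_quad_poly_exp (a b c : R) n :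
  (quad_poly a b c ^+ n.+1)`_2 *+ 2 =
  n.+1%:R * (2 * a ^+ n * c + n%:R * a ^+ n.-1 * b ^+ 2).
Proof.
elim: n => [|n IHn]; first by rewrite expr1 coef_quad_poly; ring.
rewrite exprS coefM !big_ord_recl big_ord0 /=.
rewrite /bump /= !coef_quad_poly subn0 coef0_quad_poly_exp coef1_quad_poly_exp.
rewrite addr0 mulrnDl -mulrnAr IHn.
by case: n {IHn} => [|n] /=; rewrite ?exprS -?natr1; ring.
Qed.

End QuadraticPowers.

(** * Quaternion norms and the quadratic form [axial] *)

Section QuaternionAlgebra.
Variable R : realType.
Implicit Types (q v x : quat R).

Definition sqn x : R := q0 x ^+ 2 + q1 x ^+ 2 + q2 x ^+ 2 + q3 x ^+ 2.

(* [|Im v|^2] times the squared norm of the orthogonal projection of [x] onto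
   the plane spanned by [1] and [Im v]; [axial_polar] polarizes it. *)
Definition axial v x : R :=
  sqn (qIm v) * q0 x ^+ 2 + (q1 v * q1 x + q2 v * q2 x + q3 v * q3 x) ^+ 2.

Definition axial_polar v x y : R :=
  sqn (qIm v) * q0 x * q0 y + (q1 v * q1 x + q2 v * q2 x + q3 v * q3 x) *
    (q1 v * q1 y + q2 v * q2 y + q3 v * q3 y).

Definition qi : quat R := qmk 0 1 0 0.
Definition qj : quat R := qmk 0 0 1 0.
Definition qk : quat R := qmk 0 0 0 1.

Lemma sqn_ge0 x : 0 <= sqn x.
Proof. by rewrite !addr_ge0 ?sqr_ge0. Qed.

Lemma sqn_unit x : qnorm x = 1 -> sqn x = 1.
Proof. by move=> x1; rewrite -(sqr_sqrtr (sqn_ge0 x)) [Num.sqrt _]x1 expr1n. Qed.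

Lemma sqn_unit_add t x :
  sqn (qadd (qreal 1) (qmul (qreal t) x)) = 1 + 2 * t * q0 x + t ^+ 2 * sqn x.
Proof.
case: x => [[a b] [c d]].
by rewrite /sqn /qmul /qadd /q0 /q1 /q2 /q3 /=; ring.
Qed.

(** Euler's four-square identity. *)
Lemma sqnM x y : sqn (qmul x y) = sqn x * sqn y.
Proof.
case: x y => [[a b] [c d]] [[a' b'] [c' d']].
by rewrite /sqn /qmul /q0 /q1 /q2 /q3 /=; ring.
Qed.

Lemma qnormM x y : qnorm (qmul x y) = qnorm x * qnorm y.
Proof. by rewrite /qnorm -sqrtrM ?sqn_ge0// -[LHS]/(Num.sqrt (sqn _)) sqnM. Qed.

Lemma axial_ge0 v x : 0 <= axial v x.
Proof. by rewrite addr_ge0 ?sqr_ge0// mulr_ge0 ?sqr_ge0 ?sqn_ge0. Qed.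

Lemma axial_scale v t x : axial v (qmul (qreal t) x) = t ^+ 2 * axial v x.
Proof.
case: x v => [[a b] [c d]] [[a' b'] [c' d']].
by rewrite /axial /sqn /qmul /qIm /q0 /q1 /q2 /q3 /=; ring.
Qed.

Lemma axial_unit_add v e x (t : R) :
  axial v (qmul (qadd (qreal 1) (qmul (qreal t) e)) x) =
  axial v x + (2 * axial_polar v x (qmul e x)) * t + axial v (qmul e x) * t ^+ 2.
Proof.
case: x v e => [[a b] [c d]] [[a' b'] [c' d']] [[x y] [z w]].
by rewrite /axial_polar /axial /sqn /qmul /qIm /qadd /q0 /q1 /q2 /q3 /=; ring.
Qed.

(** The quaternions x, ix, jx, kx are pairwise orthogonal of norm |x|, so [axial v] sums over all
    four to |x|^2 times its trace 2 |Im v|^2. The value at x stands on the right. *)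
Lemma sum_axial v x :
  axial v (qmul qi x) + axial v (qmul qj x) + axial v (qmul qk x) =
  2 * sqn (qIm v) * sqn x - axial v x.
Proof.
case: x v => [[a b] [c d]] [[a' b'] [c' d']].
by rewrite /axial /sqn /qmul /qIm /q0 /q1 /q2 /q3 /=; ring.
Qed.

(** Parseval in the same frame: [axial_polar v x y] is the inner product of Tx with y, where T is
    |Im v|^2 times the projection behind [axial], and |Tx|^2 = |Im v|^2 [axial v x]. The term y = x,
    which is the square of [axial v x], is subtracted. *)
Lemma sum_axial_polar v x :
  axial_polar v x (qmul qi x) ^+ 2 + axial_polar v x (qmul qj x) ^+ 2 +
    axial_polar v x (qmul qk x) ^+ 2 =
  axial v x * (sqn (qIm v) * sqn x - axial v x).
Proof.
case: x v => [[a b] [c d]] [[a' b'] [c' d']].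
by rewrite /axial_polar /axial /sqn /qmul /qIm /q0 /q1 /q2 /q3 /=; ring.
Qed.

(** The commutator ax - xa is twice the cross product of the imaginary parts, hence orthogonal to
    the real number c, and Lagrange's identity gives its norm. *)
Lemma sqn_commutator a c x :
  sqn (qadd (qadd (qmul a x) (qopp (qmul x a))) (qreal c)) =
  c ^+ 2 + 4 * (sqn (qIm a) * sqn x - axial a x).
Proof.
case: x a => [[a b] [e d]] [[a' b'] [c' d']].
by rewrite /axial /sqn /qmul /qIm /qadd /qopp /q0 /q1 /q2 /q3 /=; ring.
Qed.

(** A form of Cauchy-Schwarz, read off from [sqn_commutator] at c = 0. *)
Lemma axial_le v x : axial v x <= sqn (qIm v) * sqn x.
Proof.
have := sqn_ge0 (qadd (qadd (qmul v x) (qopp (qmul x v))) (qreal 0)).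
by rewrite sqn_commutator expr0n /= add0r pmulr_rge0// subr_ge0.
Qed.

End QuaternionAlgebra.

(** * A class of integrands closed under sums and products *)

Section BoundedMeasurable.
Variable R : realType.
Implicit Types (f g : quat R -> R).

(** The bound is asked only on the unit sphere, which carries all the mass and is stable under unit
    translations; polynomials in the coordinates then qualify. *)
Definition bdd_measurable f : Prop :=
  measurable_fun [set: quat R] f /\
  exists M, forall x, qnorm x = 1 -> `|f x| <= M.

Lemma bdd_measurable_cst r : bdd_measurable (fun=> r).
Proof. by split; [exact: measurable_cst | exists `|r|]. Qed.

Lemma bdd_measurableD f g : bdd_measurable f -> bdd_measurable g ->
  bdd_measurable (fun x => f x + g x).
Proof.
move=> [mf [M fM]] [mg [N gN]]; split; first exact: measurable_funD.
exists (M + N) => x x1.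
by rewrite (le_trans (ler_normD _ _))// lerD ?fM ?gN.
Qed.

Lemma bdd_measurableM f g : bdd_measurable f -> bdd_measurable g ->
  bdd_measurable (fun x => f x * g x).
Proof.
move=> [mf [M fM]] [mg [N gN]]; split; first exact: measurable_funM.
exists (M * N) => x x1.
by rewrite normrM ler_pM ?fM ?gN.
Qed.

Lemma bdd_measurableX f n : bdd_measurable f ->
  bdd_measurable (fun x => f x ^+ n).
Proof.
move=> bf; elim: n => [|n IHn]; first exact: bdd_measurable_cst.
by under eq_fun do rewrite exprS; exact: bdd_measurableM.
Qed.

Lemma bdd_measurable_sum (I : Type) (r : seq I) (F : I -> quat R -> R) :
  (forall i, bdd_measurable (F i)) ->
  bdd_measurable (fun x => \sum_(i <- r) F i x).
Proof.
move=> bF; elim: r => [|i r IHr].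
  by under eq_fun do rewrite big_nil; exact: bdd_measurable_cst.
by under eq_fun do rewrite big_cons; exact: bdd_measurableD.
Qed.

Lemma measurable_coords :
  [/\ measurable_fun [set: quat R] (@q0 R), measurable_fun [set: quat R] (@q1 R),
      measurable_fun [set: quat R] (@q2 R) & measurable_fun [set: quat R] (@q3 R)].
Proof.
by split; apply: measurableT_comp;
  do ?[exact: measurable_fst | exact: measurable_snd].
Qed.

Lemma bdd_measurable_coords :
  [/\ bdd_measurable (@q0 R), bdd_measurable (@q1 R),
      bdd_measurable (@q2 R) & bdd_measurable (@q3 R)].
Proof.
have [m0 m1 m2 m3] := measurable_coords.
have le1 (r s : R) : 0 <= s -> r ^+ 2 + s = 1 -> `|r| <= 1.
  move=> s0 rs1; rewrite -(@ler_pXn2r _ 2)// ?nnegrE// expr1n real_normK ?num_real//.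
  by rewrite -rs1 lerDl.
split; (split => //; exists 1 => x /sqn_unit x1).
- by apply: (le1 _ (q1 x ^+ 2 + q2 x ^+ 2 + q3 x ^+ 2));
    rewrite ?addr_ge0 ?sqr_ge0// -x1 /sqn; ring.
- by apply: (le1 _ (q0 x ^+ 2 + q2 x ^+ 2 + q3 x ^+ 2));
    rewrite ?addr_ge0 ?sqr_ge0// -x1 /sqn; ring.
- by apply: (le1 _ (q0 x ^+ 2 + q1 x ^+ 2 + q3 x ^+ 2));
    rewrite ?addr_ge0 ?sqr_ge0// -x1 /sqn; ring.
- by apply: (le1 _ (q0 x ^+ 2 + q1 x ^+ 2 + q2 x ^+ 2));
    rewrite ?addr_ge0 ?sqr_ge0// -x1 /sqn; ring.
Qed.

Lemma bdd_measurable_qmul q :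
  [/\ bdd_measurable (fun x => q0 (qmul q x)),
      bdd_measurable (fun x => q1 (qmul q x)),
      bdd_measurable (fun x => q2 (qmul q x)) &
      bdd_measurable (fun x => q3 (qmul q x))].
Proof.
have [b0 b1 b2 b3] := bdd_measurable_coords.
have bN f : bdd_measurable f -> bdd_measurable (fun x => - f x).
  move=> bf; under eq_fun do rewrite -mulN1r.
  exact: bdd_measurableM (bdd_measurable_cst _) bf.
by split; repeat (first [ exact: b0 | exact: b1 | exact: b2 | exact: b3
  | exact: bdd_measurable_cst | apply: bN
  | apply: bdd_measurableD | apply: bdd_measurableM]).
Qed.

Lemma measurable_qmul q : measurable_fun [set: quat R] (qmul q).
Proof.
have [[m0 _] [m1 _] [m2 _] [m3 _]] := bdd_measurable_qmul q.
by apply/measurable_fun_pair; apply/measurable_fun_pair.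
Qed.

Lemma bdd_measurable_axial v q : bdd_measurable (fun x => axial v (qmul q x)).
Proof.
have [b0 b1 b2 b3] := bdd_measurable_qmul q.
rewrite /axial.
apply: bdd_measurableD.
  by apply: bdd_measurableM; [exact: bdd_measurable_cst|exact: bdd_measurableX].
apply: bdd_measurableX.
by do 2?apply: bdd_measurableD; apply: bdd_measurableM => //;
  exact: bdd_measurable_cst.
Qed.

Lemma bdd_measurable_axial0 v : bdd_measurable (axial v).
Proof.
have := bdd_measurable_axial v (qreal 1).
by congr bdd_measurable; apply/funext => x; rewrite axial_scale expr1n mul1r.
Qed.

Lemma bdd_measurable_axial_polar v q :
  bdd_measurable (fun x => axial_polar v x (qmul q x)).
Proof.
have [b0 b1 b2 b3] := bdd_measurable_qmul q.
have [c0 c1 c2 c3] := bdd_measurable_coords.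
by rewrite /axial_polar; repeat (first
  [ exact: b0 | exact: b1 | exact: b2 | exact: b3
  | exact: c0 | exact: c1 | exact: c2 | exact: c3
  | exact: bdd_measurable_cst
  | apply: bdd_measurableD | apply: bdd_measurableM]).
Qed.

Lemma bdd_measurable_coef_exp (p : quat R -> {poly R}) :
  (forall i, bdd_measurable (fun x => (p x)`_i)) ->
  forall n i, bdd_measurable (fun x => (p x ^+ n)`_i).
Proof.
move=> bp; elim=> [|n IHn] i.
  by under eq_fun do rewrite expr0; exact: bdd_measurable_cst.
under eq_fun do rewrite exprS coefM.
by apply: bdd_measurable_sum => j; exact: bdd_measurableM.
Qed.

Lemma measurable_sqn : measurable_fun [set: quat R] (@sqn R).
Proof.
have [m0 m1 m2 m3] := measurable_coords.
by do 3!(apply: measurable_funD; last exact: measurable_funX);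
  exact: measurable_funX.
Qed.

Lemma measurable_unit_quats : measurable (@unit_quats R).
Proof.
have -> : @unit_quats R = (@sqn R @^-1` [set 1])%classic.
  apply/seteqP; split => x /=; first exact: sqn_unit.
  by rewrite /unit_quats /= /qnorm -/(sqn x) => ->; rewrite sqrtr1.
by rewrite -[X in measurable X]setTI; exact: measurable_sqn.
Qed.

End BoundedMeasurable.

(** Otherwise the nonzero difference would vanish at the distinct points 0, 1, 2, ..., as many as
    its size and so more than its degree. *)
Lemma poly_eq_horner (R : realType) (p q : {poly R}) :
  (forall t, p.[t] = q.[t]) -> p = q.
Proof.
move=> pq; apply/eqP; rewrite -subr_eq0; apply/negPn/negP => pq0.
pose rs : seq R := [seq i%:R | i <- iota 0 (size (p - q))].
have rs_roots : all (root (p - q)) rs.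
  by apply/allP => t _; rewrite rootE hornerD hornerN pq subrr.
have rs_uniq : uniq rs.
  by rewrite map_inj_uniq ?iota_uniq// => i j /eqP; rewrite eqr_nat => /eqP.
by have := max_poly_roots pq0 rs_roots rs_uniq; rewrite size_map size_iota ltnn.
Qed.

(** * Moments of [axial] under the Haar measure *)

Section HaarMoments.
Variables (R : realType) (mu : probability (quat R) R).
Hypothesis haar : is_haar_S3 mu.
Implicit Types (f : quat R -> R) (q v : quat R).

Local Notation D := (@unit_quats R).
Local Notation "''E' f" := (Rintegral mu D f) (at level 10, f at level 8).

Lemma integrable_bdd_measurable f :
  bdd_measurable f -> mu.-integrable D (EFin \o f).
Proof.
move=> [mf [M fM]]; apply: measurable_bounded_integrable.
- exact: measurable_unit_quats.
- by rewrite [ltLHS](proj1 haar) ltry.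
- exact: measurable_funTS.
- by exists M; split; [exact: num_real | move=> r Mr x /fM /le_trans; apply; exact: ltW].
Qed.

Lemma haar_mean_cst r : 'E (fun=> r) = r.
Proof.
rewrite Rintegral_cst; last exact: measurable_unit_quats.
by rewrite [X in fine X](proj1 haar) mulr1.
Qed.

Lemma haar_meanD f g : bdd_measurable f -> bdd_measurable g ->
  'E (fun x => f x + g x) = 'E f + 'E g.
Proof.
move=> bf bg; rewrite RintegralD//; first exact: measurable_unit_quats.
  exact: integrable_bdd_measurable.
exact: integrable_bdd_measurable.
Qed.

Lemma haar_meanZ r f : bdd_measurable f -> 'E (fun x => r * f x) = r * 'E f.
Proof.
move=> bf; rewrite RintegralZl//; first exact: measurable_unit_quats.
exact: integrable_bdd_measurable.
Qed.

Lemma haar_meanZr r f : bdd_measurable f -> 'E (fun x => f x * r) = 'E f * r.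
Proof.
by move=> bf; under eq_Rintegral do rewrite mulrC; rewrite haar_meanZ// mulrC.
Qed.

Lemma haar_mean_sum (I : Type) (r : seq I) (F : I -> quat R -> R) :
  (forall i, bdd_measurable (F i)) ->
  'E (fun x => \sum_(i <- r) F i x) = \sum_(i <- r) 'E (F i).
Proof.
move=> bF; elim: r => [|i r IHr].
  by rewrite big_nil; under eq_Rintegral do rewrite big_nil; exact: haar_mean_cst.
rewrite big_cons -IHr -haar_meanD//; last exact: bdd_measurable_sum.
by under eq_Rintegral do rewrite big_cons.
Qed.

Lemma bdd_measurable_translate f q : qnorm q = 1 ->
  bdd_measurable f -> bdd_measurable (fun x => f (qmul q x)).
Proof.
move=> q1 [mf [M fM]]; split.
  exact: (measurableT_comp mf (measurable_qmul q)).
by exists M => x x1; rewrite fM// qnormM q1 x1 mulr1.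
Qed.

(** Change of variables turns the left side into an integral against the pushforward of [mu], which
    agrees with [mu] on measurable sets by invariance; the sphere is its own preimage. *)
Lemma haar_mean_translate f q : qnorm q = 1 -> bdd_measurable f ->
  'E (fun x => f (qmul q x)) = 'E f.
Proof.
move=> q1 bf.
have preD : (qmul q @^-1` D = D)%classic.
  by apply/seteqP; split => x; rewrite /unit_quats /= qnormM q1 mul1r.
have mD := @measurable_unit_quats R.
congr fine; transitivity (\int[pushforward mu (qmul q)]_(x in D) (f x)%:E)%E.
  rewrite integral_pushforward//.
  - by rewrite preD.
  - exact: measurable_qmul.
  - by case: bf => mf _; exact/measurable_EFinP.
  - rewrite preD; apply: integrable_bdd_measurable.
    exact: bdd_measurable_translate.
apply: eq_measure_integral => [|mq A mA _]; first exact: measurable_qmul.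
exact: (proj2 haar q q1 A mA).
Qed.

(** Write q as its norm times a unit quaternion: the unit is absorbed by invariance, and the norm
    comes out because [axial v] is homogeneous of degree two. *)
Lemma haar_mean_axial_dilate v q n : 0 < sqn q ->
  'E (fun x => axial v (qmul q x) ^+ n) = sqn q ^+ n * 'E (fun x => axial v x ^+ n).
Proof.
move=> q_gt0.
have r_gt0 : 0 < qnorm q by rewrite sqrtr_gt0.
have rE : qnorm q ^+ 2 = sqn q by rewrite sqr_sqrtr// ltW.
set r := qnorm q in r_gt0 rE.
pose u := qmul (qreal r^-1) q.
have u1 : qnorm u = 1.
  rewrite qnormM -/r /qnorm /qreal /qmk /q0 /q1 /q2 /q3 /=.
  by rewrite expr0n /= !addr0 sqrtr_sqr gtr0_norm ?invr_gt0// mulVf// gt_eqF.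
have b1 : bdd_measurable (fun x => axial v x ^+ n).
  exact/bdd_measurableX/bdd_measurable_axial0.
rewrite -(haar_mean_translate u1 b1) -haar_meanZ; last first.
  exact: bdd_measurable_translate u1 b1.
apply: eq_Rintegral => x _; rewrite -exprMn; congr (_ ^+ n).
rewrite -rE -axial_scale; congr axial.
rewrite /u; move: r_gt0; case: q x {rE u u1 q_gt0} @r => [[a b] [c d]] [[x y] [z w]] r r0.
have rn0 : r != 0 by rewrite gt_eqF.
rewrite /qmul /qreal /qmk /q0 /q1 /q2 /q3 /=.
by do 2!congr pair; field.
Qed.

(** Lets an identity between means, valid for every [t], be read coefficient by coefficient. *)
Lemma haar_mean_horner (p : quat R -> {poly R}) m t :
  (forall x, (size (p x) <= m)%N) ->
  (forall i, bdd_measurable (fun x => (p x)`_i)) ->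
  'E (fun x => (p x).[t]) = (\poly_(i < m) 'E (fun x => (p x)`_i)).[t].
Proof.
move=> pm bp; rewrite horner_poly.
have bpt i : bdd_measurable (fun x => t ^+ i * (p x)`_i).
  exact: bdd_measurableM (bdd_measurable_cst _) (bp i).
transitivity (\sum_(i < m) 'E (fun x => t ^+ i * (p x)`_i)); last first.
  by apply: eq_bigr => i _; rewrite haar_meanZ// mulrC.
rewrite -haar_mean_sum//; apply: eq_Rintegral => x _.
by rewrite (horner_coef_wide _ (pm x)); apply: eq_bigr => i _; rewrite mulrC.
Qed.

(** By [axial_unit_add], the value of this polynomial at t is [axial v] at (1 + t e) x. *)
Definition axial_pencil v e x : {poly R} :=
  quad_poly (axial v x) (2 * axial_polar v x (qmul e x)) (axial v (qmul e x)).

Lemma bdd_measurable_axial_pencil v e n i :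
  bdd_measurable (fun x => (axial_pencil v e x ^+ n)`_i).
Proof.
apply: bdd_measurable_coef_exp => {}i.
have b0 := bdd_measurable_axial0 v.
have b1 := bdd_measurable_axial_polar v e.
have b2 := bdd_measurable_axial v e.
case: i => [|[|[|i]]].
- by under eq_fun do rewrite coef_quad_poly.
- under eq_fun do rewrite coef_quad_poly.
  exact: bdd_measurableM (bdd_measurable_cst _) b1.
- by under eq_fun do rewrite coef_quad_poly.
- under eq_fun do rewrite nth_default ?(leq_trans (size_quad_poly _ _ _))//.
  exact: bdd_measurable_cst.
Qed.

(* Comparison of the [t^2] coefficients in
   [E (axial v ((1 + t e) x))^n = (1 + t^2)^n E (axial v x)^n]. *)
Lemma haar_mean_coef2_axial_pencil v e n : q0 e = 0 -> sqn e = 1 ->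
  'E (fun x => (axial_pencil v e x ^+ n.+1)`_2 *+ 2) =
  2 * n.+1%:R * 'E (fun x => axial v x ^+ n.+1).
Proof.
move=> e0 e1; set M := 'E (fun x => axial v x ^+ n.+1).
have bp := bdd_measurable_axial_pencil v e n.+1.
(* Size bound for the power [n.+1] of a polynomial of degree at most two. *)
pose m := (2 * n.+1).+1.
have szp a b c : (size (quad_poly a b c ^+ n.+1) <= m)%N.
  apply: leq_trans (size_poly_exp_leq _ _) _.
  by rewrite ltnS leq_mul2r /= -subn1 leq_subLR size_quad_poly.
have /(congr1 (fun p : {poly R} => p`_2 *+ 2)) :
    \poly_(i < m) 'E (fun x => (axial_pencil v e x ^+ n.+1)`_i) =
    M *: quad_poly 1 0 1 ^+ n.+1.
  apply: poly_eq_horner => t; rewrite -haar_mean_horner //; last by move=> x; exact: szp.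
  have sq : sqn (qadd (qreal 1) (qmul (qreal t) e)) = 1 + t ^+ 2.
    by rewrite sqn_unit_add e0 e1; ring.
  have sq_gt0 : 0 < sqn (qadd (qreal 1) (qmul (qreal t) e)).
    by rewrite sq ltr_pwDl ?sqr_ge0.
  have := haar_mean_axial_dilate v n.+1 sq_gt0.
  rewrite hornerZ horner_exp horner_quad_poly mul0r addr0 mul1r sq mulrC => <-.
  apply: eq_Rintegral => x _.
  by rewrite axial_unit_add horner_exp horner_quad_poly.
have m2 : (2 < m)%N by rewrite /m ltnS mulnS leq_addr.
rewrite /= coef_poly m2 coefZ -mulrnAr coef2_quad_poly_exp !expr1n expr0n /=.
rewrite mulr0 addr0 !mulr1 mulrC [_ * 2]mulrC => <-.
by under eq_Rintegral do rewrite -mulr_natr; rewrite haar_meanZr// mulr_natr.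
Qed.

(** Add the t^2 coefficients for e = i, j, k: by [sum_axial] and [sum_axial_polar] only powers of
    [axial v x] survive, which closes a recursion on the moments. *)
Lemma haar_moment_axialS v n :
  n.+2%:R * 'E (fun x => axial v x ^+ n.+1) =
  n.+1%:R * sqn (qIm v) * 'E (fun x => axial v x ^+ n).
Proof.
set V := sqn (qIm v).
pose c e x := (axial_pencil v e x ^+ n.+1)`_2 *+ 2.
have bc e : bdd_measurable (c e).
  rewrite (_ : c e = fun x => (axial_pencil v e x ^+ n.+1)`_2 * 2%:R); last first.
    by apply/funext => x; rewrite mulr_natr.
  exact: bdd_measurableM (bdd_measurable_axial_pencil _ _ _ _)
    (bdd_measurable_cst _).
have bX k := bdd_measurableX k (bdd_measurable_axial0 v).
have cE x : x \in D -> c (qi R) x + c (qj R) x + c (qk R) x =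
    n.+1%:R * (4 * n.+1%:R * V * axial v x ^+ n
               - (4 * n%:R + 2) * axial v x ^+ n.+1).
  rewrite inE => /sqn_unit x1; rewrite /c !coef2_quad_poly_exp -!mulrDr.
  transitivity (n.+1%:R * (2 * axial v x ^+ n *
      (axial v (qmul (qi R) x) + axial v (qmul (qj R) x) + axial v (qmul (qk R) x)) +
    n%:R * axial v x ^+ n.-1 * 4 * (axial_polar v x (qmul (qi R) x) ^+ 2 +
      axial_polar v x (qmul (qj R) x) ^+ 2 + axial_polar v x (qmul (qk R) x) ^+ 2))).
    by congr (_ * _); ring.
  rewrite sum_axial sum_axial_polar -/V x1 !mulr1; congr (_ * _).
  (* The exponents [n.-1] and 1 add up to [n] only for positive [n]; at zero the factor [n%:R] kills
     the term. *)
  by case: n {c bc} => [|n] /=; rewrite ?exprS -?natr1; ring.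
have mc e : q0 e = 0 -> sqn e = 1 ->
    'E (c e) = 2 * n.+1%:R * 'E (fun x => axial v x ^+ n.+1).
  exact: haar_mean_coef2_axial_pencil.
have := haar_meanD (bdd_measurableD (bc (qi R)) (bc (qj R))) (bc (qk R)).
rewrite [X in _ = X + _]haar_meanD// !mc//;
  do ?by rewrite /sqn /q0 /q1 /q2 /q3 /=; ring.
rewrite (eq_Rintegral _ cE) haar_meanZ; last first.
  by apply: bdd_measurableD; [exact: bdd_measurableM (bdd_measurable_cst _) (bX n)
    |under eq_fun do rewrite -mulNr;
     exact: bdd_measurableM (bdd_measurable_cst _) (bX n.+1)].
under [X in _ * X]eq_Rintegral do rewrite -mulNr.
rewrite haar_meanD; [|exact: bdd_measurableM (bdd_measurable_cst _) (bX n)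
                     |exact: bdd_measurableM (bdd_measurable_cst _) (bX n.+1)].
rewrite !haar_meanZ//.
set M1 := 'E (fun x => axial v x ^+ n.+1); set M0 := 'E (fun x => axial v x ^+ n).
move=> E; have n1 : n.+1%:R != 0 :> R by rewrite pnatr_eq0.
(* The 6 is the factor 2 from each of the three units. Collecting [M1] gives 4 (n + 2) on the left,
   so a common factor 4 cancels. *)
have {}E : 6 * M1 = 4 * n.+1%:R * V * M0 + - (4 * n%:R + 2) * M1.
  by apply: (mulfI n1); rewrite E; ring.
by move: E; rewrite -!natr1; lra.
Qed.

Lemma haar_moment_axial v n :
  'E (fun x => axial v x ^+ n) = sqn (qIm v) ^+ n / n.+1%:R.
Proof.
elim: n => [|n IHn].
  by under eq_Rintegral do rewrite expr0; rewrite haar_mean_cst expr0 divr1.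
have n2 : n.+2%:R != 0 :> R by rewrite pnatr_eq0.
have n1 : n.+1%:R != 0 :> R by rewrite pnatr_eq0.
apply: (mulfI n2); rewrite haar_moment_axialS IHn [RHS]mulrC divfK//.
by rewrite [_ * sqn _]mulrC -mulrA [n.+1%:R * (_ / _)]mulrC divfK// exprS.
Qed.

End HaarMoments.

(** * Power series of the logarithm and of its Haar mean *)

Section LogSeries.
Local Open Scope classical_set_scope.
Variable R : realType.
Implicit Types (y r : R).

Definition log_term y n : R := y ^+ n.+1 / n.+1%:R.

Lemma log_term_ge0 y n : 0 <= y -> 0 <= log_term y n.
Proof. by move=> y0; rewrite divr_ge0 ?exprn_ge0. Qed.

Lemma is_derive_log_series n y :
  is_derive y (1 : R) (fun z : R => series (log_term z) n) (\sum_(k < n) y ^+ k).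
Proof.
elim: n => [|n IHn].
  rewrite big_ord0; apply: is_derive_eq.
    under eq_fun do rewrite /series /= big_geq//.
    exact: is_derive_cst.
  by [].
rewrite big_ord_recr /=.
have -> : (fun z : R => series (log_term z) n.+1) =
    (fun z => series (log_term z) n) + (fun z => log_term z n).
  by apply/funext => z; rewrite /series /= big_nat_recr.
apply: is_deriveD.
have -> : (fun z => log_term z n) = n.+1%:R^-1 \*: ((@id R) ^+ n.+1).
  by apply/funext => z; rewrite /log_term mulrC !fctE.
apply: is_derive_eq.
by rewrite /GRing.scale /= mulr1 mulrA mulVf ?mul1r// pnatr_eq0.
Qed.

(** What remains of 1 / (1 - y) after removing the first n terms of the geometric series. *)
Lemma is_derive_log_remainder n y : y < 1 ->
  is_derive y (1 : R) (fun z : R => - ln (1 - z) - series (log_term z) n)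
    (y ^+ n / (1 - y)).
Proof.
move=> y1; have y1' : 0 < 1 - y by rewrite subr_gt0.
have dl : is_derive y (1 : R) (fun z : R => ln (1 - z)) (- (1 - y)^-1).
  have d1 : is_derive y (1 : R) (fun z : R => 1 - z) (-1).
    have := is_deriveB (is_derive_cst (1 : R) y 1) (is_derive_id y (1 : R)).
    by rewrite sub0r.
  by rewrite -mulrN1; apply: is_derive1_comp; exact: is_derive1_ln.
have -> : y ^+ n / (1 - y) = - - (1 - y)^-1 - \sum_(k < n) y ^+ k.
  apply: (mulIf (lt0r_neq0 y1')).
  rewrite opprK mulrBl mulVf ?gt_eqF// mulfVK ?gt_eqF// mulrC.
  by rewrite -(opprB y) mulNr -subrX1; ring.
exact: is_deriveB (is_deriveN dl) (is_derive_log_series n y).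
Qed.

(** The mean value theorem on [0, y] writes the remainder as y c^n / (1 - c) with c in that
    interval; c is then bounded by y and the extra factor y by 1. *)
Lemma log_remainder n y : 0 <= y < 1 ->
  0 <= - ln (1 - y) - series (log_term y) n <= y ^+ n / (1 - y).
Proof.
move=> /andP[y0 y1].
pose f (z : R) : R := - ln (1 - z) - series (log_term z) n.
have df (z : R) : z <= y -> is_derive z (1 : R) f (z ^+ n / (1 - z)).
  by move=> zy; exact/is_derive_log_remainder/(le_lt_trans zy).
have f0 : f 0 = 0.
  rewrite /f subr0 ln1 oppr0 add0r /series /= big1 ?oppr0// => i _.
  by rewrite /log_term expr0n mul0r.
have [z zy||c /itvP cy] := @MVT_segment R f (fun z => z ^+ n / (1 - z)) 0 y y0.
- by apply: df; rewrite (itvP zy).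
- apply: derivable_within_continuous => z zy.
  by have /df[] : z <= y by rewrite (itvP zy).
rewrite f0 !subr0 -/(f y) => ->.
have c1 : 0 < 1 - c by rewrite subr_gt0 (le_lt_trans _ y1)// cy.
rewrite !mulr_ge0 ?invr_ge0 ?exprn_ge0 ?(ltW c1) ?cy//=.
have y1' : 0 < 1 - y by rewrite subr_gt0.
rewrite -[leRHS]mulr1 ler_pM ?(ltW y1)// ?mulr_ge0 ?invr_ge0 ?exprn_ge0 ?(ltW c1) ?cy//.
rewrite ler_pM ?invr_ge0 ?exprn_ge0 ?(ltW c1) ?cy// ?lerXn2r ?nnegrE ?cy//.
by rewrite lef_pV2// lerD2l lerN2 cy.
Qed.

Lemma cvg_log_series y : 0 <= y < 1 -> series (log_term y) @ \oo --> - ln (1 - y).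
Proof.
move=> y01; have /andP[y0 y1] := y01.
have -> : series (log_term y) =
    cst (- ln (1 - y)) - (fun n => - ln (1 - y) - series (log_term y) n).
  by apply/funext => n; rewrite !fctE; ring.
rewrite -[X in _ --> X]subr0; apply: cvgB; first exact: cvg_cst.
apply: (@squeeze_cvgr _ _ _ _ (fun=> 0) (fun n => y ^+ n / (1 - y))).
- by near=> n; exact: log_remainder.
- exact: cvg_cst.
- rewrite -[X in _ --> X](mul0r (1 - y)^-1); apply: cvgMr_tmp.
  by apply: cvg_expr; rewrite ger0_norm.
Unshelve. all: end_near. Qed.

(** The Haar mean of [log_term (k * axial v x) n] when [r] is [k * sqn (qIm v)]; the moment of order
    n + 1 supplies the factor 1 / (n + 2). *)
Definition haar_log_term r n : R := log_term r n / n.+2%:R.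

(** Partial fractions 1 / ((n + 1)(n + 2)) = 1 / (n + 1) - 1 / (n + 2), followed by an index shift
    in the second sum, which costs the factor [r^-1] and two boundary terms. *)
Lemma series_haar_log_term r n : r != 0 ->
  series (haar_log_term r) n =
  1 - (r^-1 - 1) * series (log_term r) n - r ^+ n / n.+1%:R.
Proof.
move=> r0; elim: n => [|n IHn].
  by rewrite /series /= !big_geq// expr0 divr1; ring.
move: IHn; rewrite /series /= => IHn; rewrite !big_nat_recr//=.
rewrite IHn /haar_log_term /log_term exprS.
have n1 : n.+1%:R != 0 :> R by rewrite pnatr_eq0.
have n2 : n.+2%:R != 0 :> R by rewrite pnatr_eq0.
rewrite -!natr1 in n1 n2 *; by field; rewrite n2 n1 r0.
Qed.

Lemma cvg_haar_log_series r : 0 < r <= 1 ->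
  series (haar_log_term r) @ \oo --> 1 + (r^-1 - 1) * ln (1 - r).
Proof.
move=> /andP[r0 r1].
have cz : (fun n => r ^+ n / n.+1%:R) @ \oo --> (0 : R).
  apply: (@squeeze_cvgr _ _ _ _ (fun=> 0) (@harmonic R)).
  - near=> n; rewrite mulr_ge0 ?invr_ge0 ?exprn_ge0 ?(ltW r0)//=.
    by rewrite ler_piMl ?invr_ge0 ?exprn_ile1 ?(ltW r0).
  - exact: cvg_cst.
  - exact: cvg_harmonic.
have cl : (fun n => (r^-1 - 1) * series (log_term r) n) @ \oo -->
    - ((r^-1 - 1) * ln (1 - r)).
  (* At r = 1 the logarithmic series diverges, but its coefficient [r^-1 - 1] is zero for every
     n. *)
  have [->|rn1] := eqVneq r 1.
    by rewrite invr1 subrr mul0r oppr0; under eq_fun do rewrite mul0r; exact: cvg_cst.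
  rewrite -mulrN; apply: cvgMl_tmp; apply: cvg_log_series.
  by rewrite ltW//= lt_neqAle rn1.
rewrite (_ : series _ = fun n =>
    1 - (r^-1 - 1) * series (log_term r) n - r ^+ n / n.+1%:R); last first.
  by apply/funext => n; rewrite series_haar_log_term// gt_eqF.
rewrite -[X in _ --> X]subr0 -[in X in _ --> X](opprK ((r^-1 - 1) * _)).
by apply: cvgB => //; apply: cvgB => //; exact: cvg_cst.
Unshelve. all: end_near. Qed.

Lemma nneseries_EFin (u : R^nat) l : series u @ \oo --> l ->
  (\sum_(n <oo) (u n)%:E = l%:E)%E.
Proof.
move=> ul; apply/cvg_lim => //; under eq_fun do rewrite sumEFin.
by apply: cvg_EFin; [exact: nearW | exact: ul].
Qed.

(** The endpoint y = 1 is included: the series becomes the harmonic one and both sides are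
    infinite. *)
Lemma nneseries_log_term y : 0 <= y <= 1 ->
  (\sum_(n <oo) (log_term y n)%:E = - elog (1 - y))%E.
Proof.
move=> /andP[y0]; rewrite le_eqVlt => /predU1P[->|y1]; last first.
  rewrite /elog subr_eq0 gt_eqF// -EFinN; apply: nneseries_EFin.
  by apply: cvg_log_series; rewrite y0.
rewrite /elog subrr eqxx /=; apply/cvg_lim => //.
under eq_fun do rewrite sumEFin.
rewrite (_ : (fun n => _) = (fun n => (series (@harmonic R) n)%:E)); last first.
  apply/funext => n; congr EFin; apply: eq_bigr => i _.
  by rewrite /log_term expr1n div1r.
apply/cvgeryP; apply: nondecreasing_dvgn_lt; last exact: dvg_harmonic.
by apply: nondecreasing_series => n _ _; exact: harmonic_ge0.
Qed.

End LogSeries.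

(** * Integration of the logarithmic series and the closed form *)

Section MahlerMeasure.
Variables (R : realType) (mu : probability (quat R) R).
Hypothesis haar : is_haar_S3 mu.

Local Notation D := (@unit_quats R).

(** Equals [- elog (1 - r * axial v x)] when [r * axial v x] lies in [0, 1]; the series form makes
    measurability and termwise integration immediate. *)
Definition axial_log_series (v : quat R) (r : R) (x : quat R) : \bar R :=
  (\sum_(n <oo) (log_term (r * axial v x) n)%:E)%E.

Lemma measurable_log_term_axial v r n :
  measurable_fun D (fun x => (log_term (r * axial v x) n)%:E).
Proof.
apply/measurable_EFinP/measurable_funTS; rewrite /log_term.
apply: measurable_funM => //; apply: measurable_funX.
by apply: measurable_funM => //; case: (bdd_measurable_axial0 v).
Qed.

Lemma axial_log_series_ge0 v r x : 0 <= r -> (0 <= axial_log_series v r x)%E.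
Proof.
move=> r0; apply: nneseries_ge0 => n _ _.
by rewrite lee_fin log_term_ge0// mulr_ge0 ?axial_ge0.
Qed.

Lemma measurable_axial_log_series v r : 0 <= r ->
  measurable_fun D (axial_log_series v r).
Proof.
move=> r0; apply: ge0_emeasurable_sum => [n x _ _|n _].
  by rewrite lee_fin log_term_ge0// mulr_ge0 ?axial_ge0.
exact: measurable_log_term_axial.
Qed.

Lemma integral_axial_log_series v r (s := r * sqn (qIm v)) : 0 <= r -> 0 < s <= 1 ->
  (\int[mu]_(x in D) axial_log_series v r x =
   (1 + (s^-1 - 1) * ln (1 - s))%:E)%E.
Proof.
move=> r0 s01; rewrite integral_nneseries; first last.
- by move=> n x _; rewrite lee_fin log_term_ge0// mulr_ge0 ?axial_ge0.
- by move=> n; exact: measurable_log_term_axial.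
- exact: measurable_unit_quats.
rewrite -(nneseries_EFin (cvg_haar_log_series s01)).
apply: eq_eseriesr => n _.
have bX := bdd_measurableX n.+1 (bdd_measurable_axial0 v).
(* Each term is bounded on the sphere, so its integral is finite and the real-valued moment formula
   applies. *)
transitivity ((\int[mu]_(x in D) (r ^+ n.+1 / n.+1%:R * axial v x ^+ n.+1))%R)%:E.
  rewrite /Rintegral fineK; last first.
    apply: integrable_fin_num; first exact: measurable_unit_quats.
    apply: integrable_bdd_measurable => //.
    exact: bdd_measurableM (bdd_measurable_cst _) bX.
  by apply: eq_integral => x _; rewrite /log_term exprMn mulrAC.
congr EFin; rewrite haar_meanZ// haar_moment_axial// /haar_log_term /log_term.
by rewrite /s exprMn; ring.
Qed.

(** Holds at z = 0 as well, where both sides are [-oo]: the summand with [ln A] is finite and the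
    factor one half is positive. *)
Lemma elog_sqrtM (A z : R) : 0 < A -> 0 <= z ->
  elog (Num.sqrt (A * z)) = ((ln A / 2)%:E + (2^-1)%:E * elog z)%E.
Proof.
move=> A0; rewrite le_eqVlt => /predU1P[<-|z0].
  by rewrite mulr0 sqrtr0 /elog eqxx mulrNy gtr0_sg ?invr_gt0// mul1e addeNy.
have Az : 0 < A * z by rewrite mulr_gt0.
rewrite /elog !gt_eqF ?sqrtr_gt0// -EFinM -EFinD; congr EFin.
have : ln (Num.sqrt (A * z) ^+ 2) = ln (A * z) by rewrite sqr_sqrtr// ltW.
rewrite lnXn ?sqrtr_gt0// lnM ?posrE// => E.
by rewrite mulr2n in E; lra.
Qed.

(** Here s^-1 - 1 = t^2 / 4 and 1 - s = t^2 / (4 + t^2). At t = 0 the logarithm of 1 - s has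
    coefficient zero, in agreement with the convention in [sq_log]. *)
Lemma log_closed_form (N t : R) (s := 4 / (4 + t ^+ 2)) : 0 < N -> 0 <= t ->
  ln (N ^+ 2 * (4 + t ^+ 2)) / 2 - 2^-1 * (1 + (s^-1 - 1) * ln (1 - s)) =
  ln N + 8^-1 * ((4 + t ^+ 2) * ln (4 + t ^+ 2) - 2 * sq_log t - 4).
Proof.
move=> N0 t0; have w0 : 0 < 4 + t ^+ 2 by rewrite ltr_pwDl ?sqr_ge0.
have sE : s^-1 - 1 = t ^+ 2 / 4.
  by rewrite /s; field; rewrite gt_eqF.
rewrite lnM ?posrE ?exprn_gt0// lnXn// sE /sq_log.
case: eqVneq => [->|tn0]; first by rewrite expr0n /= addr0 mulr2n; lra.
have tp : 0 < t by rewrite lt_neqAle eq_sym tn0.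
have -> : 1 - s = t ^+ 2 / (4 + t ^+ 2).
  by rewrite /s; field; rewrite gt_eqF.
by rewrite ln_div ?posrE ?exprn_gt0// lnXn// !mulr2n; field.
Qed.

End MahlerMeasure.

Theorem theorem6p3 (R : realType) (mu : probability (quat R) R)
  (a : quat R) (c : R) :
  is_haar_S3 mu ->
  qIm a <> qreal 0 ->
  let L := fun x : quat R =>
    qadd (qadd (qmul a x) (qopp (qmul x a))) (qreal c) in
  let c0 := `|c| / qnorm (qIm a) in
  mahlerH mu L =
    (ln (qnorm (qIm a)) +
     8^-1 * ((4 + c0 ^+ 2) * ln (4 + c0 ^+ 2) - 2 * sq_log c0 - 4))%:E.
Proof.
move=> haar a0 L c0; set N := qnorm (qIm a) in c0 *.
have V0 : 0 < sqn (qIm a).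
  rewrite lt_neqAle sqn_ge0 andbT eq_sym; apply/eqP => V0; apply: a0.
  move: V0; rewrite /sqn /qIm /q0 /q1 /q2 /q3 /=; case: a {L c0 N} => [[? b] [e d]] /=.
  move/eqP; rewrite expr0n add0r !paddr_eq0 ?addr_ge0 ?sqr_ge0// !sqrf_eq0.
  by move=> /andP[/andP[/eqP-> /eqP->] /eqP->].
have NV : N ^+ 2 = sqn (qIm a) by rewrite sqr_sqrtr// ltW.
have N0 : 0 < N by rewrite sqrtr_gt0.
have c00 : 0 <= c0 by rewrite divr_ge0// ltW.
have w0 : 0 < 4 + c0 ^+ 2 by rewrite ltr_pwDl ?sqr_ge0.
have cE : c ^+ 2 = N ^+ 2 * c0 ^+ 2.
  by rewrite /c0 expr_div_n real_normK ?num_real// mulrC divfK// expf_neq0// gt_eqF.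
(* Chosen so that on the sphere |L(x)|^2 = N^2 c0^2 + 4 (N^2 - [axial a x]) factors as
   [A * (1 - r * axial a x)] with A = N^2 (4 + c0^2) and r = 4 / A. Then [s] is the largest value
   allowed for [r * axial a x] by [axial_le]. *)
pose s := 4 / (4 + c0 ^+ 2); pose r := s / N ^+ 2.
have s0 : 0 < s by rewrite divr_gt0.
have s1 : s <= 1 by rewrite ler_pdivrMr// mul1r lerDl sqr_ge0.
have r0 : 0 <= r by rewrite divr_ge0 ?sqr_ge0// ltW.
have rV : r * sqn (qIm a) = s by rewrite -NV divfK// expf_neq0// gt_eqF.
have rV01 : 0 < r * sqn (qIm a) <= 1 by rewrite rV s0.
pose A := N ^+ 2 * (4 + c0 ^+ 2).
have A0 : 0 < A by rewrite mulr_gt0 ?exprn_gt0.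
have mD := @measurable_unit_quats R.
have LE x : x \in unit_quats (R := R) -> elog (qnorm (L x)) =
    ((ln A / 2)%:E - (2^-1)%:E * axial_log_series a r x)%E.
  rewrite inE => /sqn_unit x1.
  have s01 : 0 <= r * axial a x <= 1.
    rewrite mulr_ge0 ?axial_ge0//= (le_trans _ s1)// -rV ler_wpM2l//.
    by have := axial_le a x; rewrite x1 mulr1.
  rewrite /axial_log_series nneseries_log_term// muleN oppeK -elog_sqrtM//; last first.
    by rewrite subr_ge0; case/andP: s01.
  rewrite -[qnorm _]/(Num.sqrt (sqn _)) sqn_commutator x1 mulr1 -NV cE.
  congr (elog (Num.sqrt _)); rewrite /A /r /s; field.
  by rewrite !gt_eqF.
rewrite /mahlerH (eq_integral _ _ LE).
(* The series may take the value [+oo], so splitting the integral of the difference rests on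
   integrability; the terms being nonnegative, the finite integral just computed suffices. *)
have intS : mu.-integrable (@unit_quats R) (axial_log_series a r).
  apply/integrableP; split; first exact: measurable_axial_log_series.
  under eq_integral do rewrite gee0_abs ?axial_log_series_ge0//.
  by rewrite integral_axial_log_series// ltry.
rewrite integralB//; first last.
- exact: integrableZl.
- exact: finite_measure_integrable_cst.
rewrite integralZl// integral_axial_log_series// integral_cst//.
rewrite [X in (_ * X - _)%E](proj1 haar) mule1 -EFinM -EFinB rV.
by rewrite log_closed_form.
Qed.
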